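(* Let $k$ be a field, $V$ a $k$-vector space, $\mathcal H=T(V)$ and $\mathcal H^+=\bigoplus_{n\ge 1}V^{\otimes n}$, endowed with the shuffle quadri-algebra operations $\searrow,\nearrow,\nwarrow,\swarrow$, the derived operations $\succ,\prec,\vee,\wedge$, the concatenation product and the deconcatenation coproduct $\Delta(u)=\sum_{u=u^1u^2}u^1\otimes u^2$. Then for any $u\in\mathcal H$ and $v,w\in\mathcal H^+$: \begin{enumerate} \item $u\nearrow(vw)=\sum_{u=u^1u^2}(u^1\searrow v)(u^2\wedge w)=\sum_{u=u^1u^2}(u^1\succ v)(u^2\nearrow w)$, \item $u\searrow(vw)=\sum_{u=u^1u^2}(u^1\searrow v)(u^2\vee w)=\sum_{u=u^1u^2}(u^1\succ v)(u^2\searrow w)$, \item $u\swarrow(vw)=\sum_{u=u^1u^2}(u^1\swarrow v)(u^2\vee w)=\sum_{u=u^1u^2}(u^1\prec v)(u^2\searrow w)$, \item $u\nwarrow(vw)=\sum_{u=u^1u^2}(u^1\swarrow v)(u^2\wedge w)=\sum_{u=u^1u^2}(u^1\prec v)(u^2\nearrow w)$. \end{enumerate}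
   Context: $\mathcal H=T(V)=\bigoplus_{n\ge0}V^{\otimes n}$, with empty word $\mathbf 1$ spanning $V^{\otimes 0}=k$. Words (pure tensors) are written $u=u_1\cdots u_p$ with $u_i\in V$. Juxtaposition $uv=m(u\otimes v)$ is concatenation. The deconcatenation coproduct is $\Delta(u)=\sum_{u=u^1u^2}u^1\otimes u^2$; for a word $u$ of length $p$ the sum runs over all $p+1$ ways of cutting $u$ into a prefix $u^1$ and a suffix $u^2$ (each possibly equal to $\mathbf 1$), and the notation $\sum_{u=u^1u^2}$ is extended linearly to all $u\in\mathcal H$. Quadri-algebra operations. Let $\mathrm{Sh}(p,q)$ be the set of permutations $\sigma\in S_{p+q}$ with $\sigma(1)<\cdots<\sigma(p)$ and $\sigma(p+1)<\cdots<\sigma(p+q)$. For $p,q\ge1$, $u=u_1\cdots u_p$ and $v=u_{p+1}\cdots u_{p+q}$, each of the four bilinear operations is given by $\sum_\sigma u_{\sigma^{-1}(1)}u_{\sigma^{-1}(2)}\cdots u_{\sigma^{-1}(p+q)}$, the sum being over the $\sigma\in\mathrm{Sh}(p,q)$ such that: - for $u\searrow v$: $\sigma^{-1}(1)=p+1$ and $\sigma^{-1}(p+q)=p+q$ (first letter and last letter both come from $v$); - for $u\nearrow v$: $\sigma^{-1}(1)=p+1$ and $\sigma^{-1}(p+q)=p$ (first letter from $v$, last letter from $u$); - for $u\nwarrow v$: $\sigma^{-1}(1)=1$ and $\sigma^{-1}(p+q)=p$ (first and last letters from $u$); - for $u\swarrow v$: $\sigma^{-1}(1)=1$ and $\sigma^{-1}(p+q)=p+q$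 (first letter from $u$, last letter from $v$). An empty sum is $0$. For $a\in\mathcal H^+$ one sets $\mathbf 1\searrow a=a$, $\mathbf 1\nearrow a=\mathbf 1\nwarrow a=\mathbf 1\swarrow a=0$, and $a\nwarrow\mathbf 1=a$, $a\nearrow\mathbf 1=a\searrow\mathbf 1=a\swarrow\mathbf 1=0$. (The operations are not defined on $\mathbf 1\otimes\mathbf 1$.) In particular all operations are defined as linear maps $\mathcal H\otimes\mathcal H^+\to\mathcal H^+$. Derived operations: $x\succ y=x\nearrow y+x\searrow y$, $x\prec y=x\nwarrow y+x\swarrow y$, $x\vee y=x\searrow y+x\swarrow y$, $x\wedge y=x\nearrow y+x\nwarrow y$. *)

(* Defs.v *)
From HB Require Import structures.
From mathcomp Require Import all_boot all_order all_algebra all_fingroup.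
From mathcomp Require Import boolp.
From mathcomp Require Import finmap monalg zify.

Set Implicit Arguments.
Unset Strict Implicit.
Unset Printing Implicit Defensive.

Import GRing.Theory.
Local Open Scope ring_scope.
Local Open Scope quotient_scope.

Inductive lspan (k : fieldType) (M : lmodType k) (R : M -> Prop) : M -> Prop :=
| lspan0 : lspan R 0
| lspanP a x y : R x -> lspan R y -> lspan R (a *: x + y).

Section Span.
Variables (k : fieldType) (M : lmodType k) (R : M -> Prop).

Lemma lspanD x y : lspan R x -> lspan R y -> lspan R (x + y).
Proof.
by move=> Hx Hy; elim: Hx => [|a z t Hz _ IH]; rewrite ?add0r // -addrA; apply: lspanP.
Qed.

Lemma lspanZ a x : lspan R x -> lspan R (a *: x).
Proof.
elim=> [|b z t Hz _ IH]; first by rewrite scaler0; apply: lspan0.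
by rewrite scalerDr scalerA; apply: lspanP.
Qed.

End Span.

Section Presented.
Variables (k : fieldType) (K : choiceType) (R : {malg k[K]} -> Prop).

Definition relsub (x : {malg k[K]}) := `[< lspan R x >].

Lemma relsubP x : reflect (lspan R x) (x \in relsub).
Proof. exact: asboolP. Qed.

Fact relsub_closed : zmod_closed relsub.
Proof.
split=> [|x y /relsubP Hx /relsubP Hy]; apply/relsubP; first exact: lspan0.
by apply: lspanD => //; rewrite -scaleN1r; apply: lspanZ.
Qed.

HB.instance Definition _ := GRing.isZmodClosed.Build _ relsub relsub_closed.
Definition relsubmod : zmodClosed {malg k[K]} := GRing.ZmodClosed.clone {malg k[K]} relsub _.

(* The vector space with basis K, modulo the subspace spanned by R. *)
Definition presented : Type := Quotient.quot relsubmod.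
HB.instance Definition _ := Choice.on presented.
HB.instance Definition _ := GRing.Zmodule.on presented.

Definition pclass (x : {malg k[K]}) : presented := \pi_(Quotient.quot relsubmod) x.

Lemma pclass_eq x y : pclass x = pclass y <-> lspan R (x - y).
Proof.
split=> [/eqP|/relsubP H]; last by apply/eqP; rewrite -Quotient.idealrBE.
by rewrite -Quotient.idealrBE => /relsubP.
Qed.

Lemma pclass_zmod : zmod_morphism pclass.
Proof. by move=> x y; rewrite /pclass raddfB. Qed.

HB.instance Definition _ :=
  GRing.isZmodMorphism.Build {malg k[K]} presented pclass pclass_zmod.

Definition prepr (t : presented) : {malg k[K]} := generic_quotient.repr (t : Quotient.quot relsubmod).

Lemma preprK : cancel prepr pclass.
Proof. by move=> t; rewrite /pclass /prepr reprK. Qed.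

Definition pscale (a : k) (t : presented) : presented := pclass (a *: prepr t).

Lemma pscaleE a x : pscale a (pclass x) = pclass (a *: x).
Proof.
rewrite /pscale; apply/pclass_eq; rewrite -scalerBr; apply: lspanZ.
by apply/pclass_eq; rewrite preprK.
Qed.

Fact pscaleA a b t : pscale a (pscale b t) = pscale (a * b) t.
Proof. by rewrite -[t]preprK !pscaleE scalerA. Qed.
Fact pscale1 : left_id 1 pscale.
Proof. by move=> t; rewrite -[t]preprK !pscaleE scale1r. Qed.
Fact pscaleDr : right_distributive pscale +%R.
Proof.
by move=> a s t; rewrite -[s]preprK -[t]preprK -raddfD !pscaleE -raddfD scalerDr.
Qed.
Fact pscaleDl t : {morph pscale^~ t : a b / a + b}.
Proof. by move=> a b /=; rewrite -[t]preprK !pscaleE -raddfD scalerDl. Qed.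

HB.instance Definition _ :=
  GRing.Zmodule_isLmodule.Build k presented pscaleA pscale1 pscaleDr pscaleDl.

Lemma pclass_scalable : scalable pclass.
Proof. by move=> a x; rewrite -pscaleE. Qed.

HB.instance Definition _ :=
  GRing.isScalable.Build k {malg k[K]} presented *:%R pclass pclass_scalable.

End Presented.

HB.lock Definition pgen (k : fieldType) (K : choiceType)
  (R : {malg k[K]} -> Prop) (x : K) : presented R := pclass R << x >>.

Section Extension.
Variables (k : fieldType) (K : choiceType) (M : lmodType k).

Definition lin_ext (f : K -> M) (x : {malg k[K]}) : M :=
  \sum_(a <- msupp x) x@_a *: f a.

Lemma lin_extEw f (d : {fset K}) x : (msupp x `<=` d)%fset ->
  lin_ext f x = \sum_(a <- d) x@_a *: f a.
Proof.
move=> le_xd; rewrite /lin_ext (big_fset_incl _ le_xd) // => a _ /mcoeff_outdom ->.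
by rewrite scale0r.
Qed.

Lemma lin_ext_linear f : linear (lin_ext f).
Proof.
move=> a x y; set d := (msupp (a *: x + y) `|` msupp x `|` msupp y)%fset.
rewrite (@lin_extEw _ d (_ + _)) ?(@lin_extEw _ d x) ?(@lin_extEw _ d y) /d.
- rewrite scaler_sumr -big_split /=; apply: eq_bigr => b _.
  by rewrite mcoeffD mcoeffZ scalerDl scalerA.
- by rewrite fsubsetUr.
- by rewrite (fsubset_trans _ (fsubsetUl _ _)) ?fsubsetUr.
by rewrite -fsetUA fsubsetUl.
Qed.

HB.instance Definition _ f :=
  GRing.isLinear.Build k {malg k[K]} M *:%R (lin_ext f) (lin_ext_linear f).

Lemma lin_extB f x y : lin_ext f (x - y) = lin_ext f x - lin_ext f y.
Proof. exact: raddfB. Qed.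

Lemma lin_extZ f a x : lin_ext f (a *: x) = a *: lin_ext f x.
Proof. exact: linearZ. Qed.

Lemma lin_extU f x : lin_ext f << x >> = f x.
Proof.
by rewrite (@lin_extEw _ [fset x]%fset) ?msuppU_le // big_seq_fset1 mcoeffUU scale1r.
Qed.

End Extension.

(* The map induced by f on the quotient. It evaluates f on a chosen
   representative, so it is meaningful only when f respects R; plift_class and
   plift_linear state that it is then the induced linear map. *)
HB.lock Definition plift (k : fieldType) (K : choiceType)
  (R : {malg k[K]} -> Prop) (M : lmodType k) (f : K -> M) (t : presented R) : M :=
  lin_ext f (prepr t).

Section PresentedTheory.
Variables (k : fieldType) (K : choiceType) (R : {malg k[K]} -> Prop).

Section Lift.
Variable (M : lmodType k).

Definition respects (f : K -> M) := forall x, R x -> lin_ext f x = 0.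

Lemma plift_class f x : respects f -> plift f (pclass R x) = lin_ext f x.
Proof.
move=> Rf; rewrite plift.unlock; apply/eqP; rewrite -subr_eq0 -lin_extB; apply/eqP.
have: lspan R (prepr (pclass R x) - x) by apply/pclass_eq; rewrite preprK.
elim=> [|a y z Ry _ IH] /=; first exact: raddf0.
by rewrite /= lin_ext_linear IH Rf // scaler0 addr0.
Qed.

Lemma plift_gen f x : respects f -> plift f (pgen R x) = f x.
Proof. by move=> Rf; rewrite pgen.unlock plift_class // lin_extU. Qed.

Lemma plift_linear f : respects f -> linear (@plift k K R M f).
Proof.
move=> Rf a s t; rewrite -[s]preprK -[t]preprK -linearP !plift_class //.
by rewrite linearP.
Qed.

End Lift.

Lemma presented_ind (P : presented R -> Prop) : P 0 ->
  (forall a x t, P t -> P (a *: pgen R x + t)) -> forall t, P t.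
Proof.
move=> P0 PD t; rewrite -[t]preprK (monalgE (prepr t)) raddf_sum.
elim: (X in \sum_(a <- X) _) => [|x s IH]; first by rewrite big_nil.
rewrite big_cons; move: (PD (prepr t)@_x x _ IH); congr (P (_ + _)).
rewrite pgen.unlock -linearZ; congr pclass; apply/malgP => y.
by rewrite mcoeffZ !mcoeffU mulr_natr.
Qed.

End PresentedTheory.

Section Multilinear.
Variables (k : fieldType) (V M : lmodType k).

(* f restricts to a multilinear map on the words of each length. *)
Definition multilinear (f : seq V -> M) :=
  forall (s t : seq V) (a : k) (x y : V),
    f (s ++ (a *: x + y) :: t) = a *: f (s ++ x :: t) + f (s ++ y :: t).

Lemma multilinear_sum (I : Type) (r : seq I) (P : pred I) (F : I -> seq V -> M) :
  (forall i, multilinear (F i)) ->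
  multilinear (fun u => \sum_(i <- r | P i) F i u).
Proof.
move=> FM s t a x y; rewrite scaler_sumr -big_split /=.
by apply: eq_bigr => i _; rewrite FM.
Qed.

End Multilinear.

Lemma lin_map0 (k : fieldType) (U W : lmodType k) (h : U -> W) : linear h -> h 0 = 0.
Proof.
move=> hL; have := hL 1 0 0; rewrite !scale1r addr0 => /eqP.
by rewrite -[X in X == _]addr0 (inj_eq (addrI _)) eq_sym => /eqP.
Qed.

Lemma lin_map_sum (k : fieldType) (U W : lmodType k) (h : U -> W) (I : Type)
    (r : seq I) (F : I -> U) :
  linear h -> h (\sum_(i <- r) F i) = \sum_(i <- r) h (F i).
Proof.
move=> hL; elim: r => [|i r IH]; first by rewrite !big_nil lin_map0.
by rewrite !big_cons -IH -[F i]scale1r hL !scale1r.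
Qed.

Section TensorAlgebra.
Variables (k : fieldType) (V : lmodType k).

Definition tens_rel (z : {malg k[seq V]}) : Prop :=
  exists (s t : seq V) (a : k) (x y : V),
    z = << s ++ (a *: x + y) :: t >> - a *: << s ++ x :: t >> - << s ++ y :: t >>.

(* T(V): linear combinations of words over V modulo multilinearity in the
   letters. The relations preserve the length of words, so this is the direct
   sum of the spaces obtained from the words of each length n, each of which
   is the n-th tensor power of V. *)
Definition tensalg : Type := presented tens_rel.
HB.instance Definition _ := GRing.Lmodule.on tensalg.

(* The pure tensor u_1 ... u_p. *)
Definition word (u : seq V) : tensalg := pgen tens_rel u.

(* The linear extension to T(V) of f, when f is multilinear on words. *)
Definition tens_ext (M : lmodType k) (f : seq V -> M) : tensalg -> M :=
  @plift k (seq V) tens_rel M f.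

Section Ext.
Variables (M : lmodType k) (f : seq V -> M).
Hypothesis fM : multilinear f.

Lemma tens_respects : respects tens_rel f.
Proof.
move=> _ [s [t [a [x [y ->]]]]].
by rewrite !lin_extB lin_extZ !lin_extU fM -addrA -opprD subrr.
Qed.

Lemma tens_ext_word u : tens_ext f (word u) = f u.
Proof. by rewrite /tens_ext plift_gen //; exact: tens_respects. Qed.

Lemma tens_ext_linear : linear (tens_ext f).
Proof. by apply: plift_linear; exact: tens_respects. Qed.
End Ext.

Lemma tens_ind (P : tensalg -> Prop) : P 0 ->
  (forall a u t, P t -> P (a *: word u + t)) -> forall t, P t.
Proof. exact: presented_ind. Qed.

Lemma tens_lin_eq (M : lmodType k) (f g : tensalg -> M) :
  linear f -> linear g -> (forall u, f (word u) = g (word u)) -> f =1 g.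
Proof.
move=> fL gL fg.
by elim/tens_ind=> [|a u t IH]; rewrite ?(lin_map0 fL) ?(lin_map0 gL) // fL gL fg IH.
Qed.

Lemma word_multilinear : multilinear word.
Proof.
move=> s t a x y; rewrite /word pgen.unlock -linearZ -raddfD; apply/pclass_eq.
rewrite -[X in lspan _ X]addr0 -[X in X + 0]scale1r; apply: lspanP; last exact: lspan0.
by exists s, t, a, x, y; rewrite opprD addrA.
Qed.

Definition tens_ext2 (M : lmodType k) (f : seq V -> seq V -> M) (x y : tensalg) : M :=
  tens_ext (fun u => tens_ext (f u) y) x.

Section Ext2.
Variables (M : lmodType k) (f : seq V -> seq V -> M).
Hypothesis fMl : forall v, multilinear (f^~ v).
Hypothesis fMr : forall u, multilinear (f u).

Let aux y : multilinear (fun u => tens_ext (f u) y).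
Proof.
move=> s t a x x'; move: y; apply: tens_lin_eq.
- exact: tens_ext_linear.
- move=> b y y'; rewrite !tens_ext_linear // !scalerDr !scalerA mulrC.
  by rewrite addrACA.
by move=> v; rewrite !tens_ext_word //; exact: fMl.
Qed.

Lemma tens_ext2_linearl y : linear (tens_ext2 f ^~ y).
Proof. by move=> a x x'; rewrite /tens_ext2 tens_ext_linear. Qed.

Lemma tens_ext2_linearr x : linear (tens_ext2 f x).
Proof.
move=> a y y'; move: x; apply: tens_lin_eq.
- exact: tens_ext2_linearl.
- move=> b x x'; rewrite !tens_ext2_linearl !scalerDr !scalerA mulrC.
  by rewrite addrACA.
by move=> u; rewrite /tens_ext2 !tens_ext_word // tens_ext_linear.
Qed.

Lemma tens_ext2_word u v : tens_ext2 f (word u) (word v) = f u v.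
Proof. by rewrite /tens_ext2 !tens_ext_word. Qed.
End Ext2.

End TensorAlgebra.

Section Concatenation.
Variables (k : fieldType) (V : lmodType k).
Local Notation H := (tensalg V).

Definition tens_mul : H -> H -> H := tens_ext2 (fun u v => word (u ++ v)).

Let catMl v : multilinear (fun u : seq V => word (u ++ v)).
Proof. by move=> s t a x y; rewrite -!catA word_multilinear. Qed.

Let catMr (u : seq V) : multilinear (fun v => word (u ++ v)).
Proof. by move=> s t a x y; rewrite !catA word_multilinear. Qed.

Let mulLl y : linear (tens_mul^~ y).
Proof. exact: tens_ext2_linearl. Qed.

Let mulLr x : linear (tens_mul x).
Proof. exact: tens_ext2_linearr. Qed.

Lemma tens_mul_word (u v : seq V) : tens_mul (word u) (word v) = word (u ++ v).
Proof. exact: tens_ext2_word. Qed.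

Fact tens_mulDl : left_distributive tens_mul +%R.
Proof. by move=> x y z; have := mulLl z 1 x y; rewrite !scale1r. Qed.

Fact tens_mulDr : right_distributive tens_mul +%R.
Proof. by move=> z x y; have := mulLr z 1 x y; rewrite !scale1r. Qed.

Fact tens_mul1 : left_id (word [::]) tens_mul.
Proof.
apply: tens_lin_eq => [||u]; [exact: mulLr|by []|].
by rewrite tens_mul_word.
Qed.

Fact tens_mulr1 : right_id (word [::]) tens_mul.
Proof.
apply: tens_lin_eq => [||u]; [exact: mulLl|by []|].
by rewrite tens_mul_word cats0.
Qed.

Fact tens_mulA : associative tens_mul.
Proof.
move=> x y z.
pose f1 x : H := tens_mul x (tens_mul y z); pose g1 x : H := tens_mul (tens_mul x y) z.
suff /(_ x): f1 =1 g1 by []; apply: tens_lin_eq => [a t t'|a t t'|u].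
- exact: mulLl.
- by rewrite /g1 !mulLl.
pose f2 y : H := tens_mul (word u) (tens_mul y z).
pose g2 y : H := tens_mul (tens_mul (word u) y) z.
suff /(_ y): f2 =1 g2 by []; apply: tens_lin_eq => [a t t'|a t t'|v].
- by rewrite /f2 mulLl mulLr.
- by rewrite /g2 mulLr mulLl.
pose f3 z : H := tens_mul (word u) (tens_mul (word v) z).
pose g3 z : H := tens_mul (tens_mul (word u) (word v)) z.
suff /(_ z): f3 =1 g3 by []; apply: tens_lin_eq => [a t t'|a t t'|w].
- by rewrite /f3 !mulLr.
- exact: mulLr.
by rewrite /f3 /g3 !tens_mul_word catA.
Qed.

Fact tens_oner_neq0 : word [::] != 0 :> H.
Proof.
pose f (u : seq V) : k^o := (u == [::])%:R.
have fM : multilinear f by move=> [|x0 s] t a x y; rewrite /f /= scaler0 addr0.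
apply/eqP => /(congr1 (tens_ext f)); rewrite tens_ext_word // (lin_map0 (tens_ext_linear fM)).
by move/eqP; rewrite /f eqxx oner_eq0.
Qed.

HB.instance Definition _ := GRing.Zmodule_isNzRing.Build H
  tens_mulA tens_mul1 tens_mulr1 tens_mulDl tens_mulDr tens_oner_neq0.

Fact tens_scaleAl (a : k) (x y : H) : a *: (x * y) = (a *: x) * y.
Proof.
have := mulLl y a x 0; rewrite addr0 -[tens_mul 0 y]/(0 * y) mul0r addr0.
exact: esym.
Qed.
Fact tens_scaleAr (a : k) (x y : H) : a *: (x * y) = x * (a *: y).
Proof.
have := mulLr x a y 0; rewrite addr0 -[tens_mul x 0]/(x * 0) mulr0 addr0.
exact: esym.
Qed.

HB.instance Definition _ := GRing.Lmodule_isLalgebra.Build k H tens_scaleAl.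
HB.instance Definition _ := GRing.Lalgebra_isAlgebra.Build k H tens_scaleAr.

Lemma wordM (u v : seq V) : word u * word v = word (u ++ v).
Proof. exact: tens_mul_word. Qed.

(* The augmentation ideal, i.e. the sum of the tensor powers of degree at
   least 1. *)
Definition tens_pos : H -> Prop :=
  lspan (fun x => exists2 u : seq V, u != [::] & x = word u).

End Concatenation.

Section TensorProduct.
Variables (k : fieldType) (M N : lmodType k).

Definition tprod_rel (z : {malg k[(M * N)%type]}) : Prop :=
  (exists a x x' y,
     z = << (a *: x + x', y) >> - a *: << (x, y) >> - << (x', y) >>) \/
  (exists a x y y',
     z = << (x, a *: y + y') >> - a *: << (x, y) >> - << (x, y') >>).

Definition tprod : Type := presented tprod_rel.
HB.instance Definition _ := GRing.Lmodule.on tprod.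

Definition tpure (x : M) (y : N) : tprod := pgen tprod_rel (x, y).

(* The linear map on the tensor product induced by B, when B is bilinear. *)
Definition tprod_ext (P : lmodType k) (B : M -> N -> P) : tprod -> P :=
  @plift k (M * N)%type tprod_rel P (fun z => B z.1 z.2).

Definition bilin (P : lmodType k) (B : M -> N -> P) :=
  (forall y, linear (B^~ y)) /\ (forall x, linear (B x)).

Lemma tpure_bilin : bilin tpure.
Proof.
split=> [y|x] a z z'; rewrite /tpure pgen.unlock -linearZ -raddfD; apply/pclass_eq;
  rewrite -[X in lspan _ X]addr0 -[X in X + 0]scale1r; (apply: lspanP; last exact: lspan0).
- by left; exists a, z, z', y; rewrite opprD addrA.
- by right; exists a, x, z, z'; rewrite opprD addrA.
Qed.

Section Ext.
Variables (P : lmodType k) (B : M -> N -> P).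
Hypothesis BL : bilin B.

Let respB : respects tprod_rel (fun z => B z.1 z.2).
Proof.
move=> _ [[a [x [x' [y ->]]]]|[a [x [y [y' ->]]]]];
  rewrite !lin_extB lin_extZ !lin_extU /=.
- by rewrite BL.1 -addrA -opprD subrr.
- by rewrite BL.2 -addrA -opprD subrr.
Qed.

Lemma tprod_ext_pure x y : tprod_ext B (tpure x y) = B x y.
Proof. by rewrite /tprod_ext plift_gen. Qed.

Lemma tprod_ext_linear : linear (tprod_ext B).
Proof. exact: plift_linear. Qed.
End Ext.

End TensorProduct.

Section Coproduct.
Variables (k : fieldType) (V : lmodType k).
Local Notation H := (tensalg V).

Definition deconc_word (u : seq V) : tprod H H :=
  \sum_(i < (size u).+1) tpure (word (take i u)) (word (drop i u)).

Definition deconc : H -> tprod H H := tens_ext deconc_word.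

(* The sum of B(u^1, u^2) over the decompositions u = u^1 u^2, extended linearly
   in u; it is meaningful for bilinear B, see deconc_sum_word. *)
Definition deconc_sum (M : lmodType k) (u : H) (B : H -> H -> M) : M :=
  tprod_ext B (deconc u).

Lemma deconc_multilinear : multilinear deconc_word.
Proof.
move=> s t a x y; rewrite /deconc_word !size_cat /= scaler_sumr -big_split /=.
apply: eq_bigr => i _; rewrite !take_cat !drop_cat; case: ltnP => _.
  by rewrite word_multilinear (tpure_bilin _ _).2.
case: (_ - _)%N => [|j] /=; first by rewrite (word_multilinear [::]) (tpure_bilin _ _).2.
by rewrite word_multilinear (tpure_bilin _ _).1.
Qed.

Lemma deconcE u : deconc (word u) = deconc_word u.
Proof. exact: tens_ext_word deconc_multilinear u. Qed.

Lemma deconc_sum_linear (M : lmodType k) (B : H -> H -> M) :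
  bilin B -> linear (fun u => deconc_sum u B).
Proof.
move=> BL a u v.
by rewrite /deconc_sum /deconc (tens_ext_linear deconc_multilinear) tprod_ext_linear.
Qed.

Lemma deconc_sum_word (M : lmodType k) (B : H -> H -> M) u : bilin B ->
  deconc_sum (word u) B =
  \sum_(i < (size u).+1) B (word (take i u)) (word (drop i u)).
Proof.
move=> BL; rewrite /deconc_sum deconcE /deconc_word.
rewrite (lin_map_sum _ _ (tprod_ext_linear BL)).
by apply: eq_bigr => i _; exact: tprod_ext_pure.
Qed.

End Coproduct.

Section Shuffles.

(* Positions are numbered from 0. *)
Definition Sh (p q : nat) : {set 'S_(p + q)} :=
  [set s : 'S_(p + q) |
    [forall i : 'I_(p + q), forall j : 'I_(p + q),
      (i < j)%N && ((j < p)%N || (p <= i)%N) ==> (s i < s j)%N]].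

(* The shuffles s whose first and last positions receive the letters number a
   and b respectively. *)
Definition Sh_ends (p q a b : nat) : {set 'S_(p + q)} :=
  [set s in Sh p q |
    [forall i : 'I_(p + q),
      ((i == 0%N :> nat) ==> ((s^-1)%g i == a :> nat)) &&
      ((i.+1 == (p + q)%N) ==> ((s^-1)%g i == b :> nat))]].

Variables (k : fieldType) (V : lmodType k).
Local Notation H := (tensalg V).

(* The word u_(s^-1(1)) ... u_(s^-1(n)). *)
Definition perm_word (n : nat) (u : seq V) (s : 'S_n) : seq V :=
  [seq u`_((s^-1)%g i) | i : 'I_n].

(* The sum over the shuffles of u and v with prescribed ends, extended to the
   empty word by [] * v = l v and u * [] = r u. The value at a pair of empty
   words is a dummy one. *)
Definition shuffle_word (a b : nat -> nat -> nat) (l r : bool) (u v : seq V) : H :=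
  if u == [::] then (if v == [::] then 0 else word v *+ l)
  else if v == [::] then word u *+ r
  else \sum_(s in Sh_ends (size u) (size v)
              (a (size u) (size v)) (b (size u) (size v)))
         word (perm_word (u ++ v) s).

Lemma perm_word_multilinear n (s : 'S_n) u1 u2 (c : k) (x y : V) :
  size (u1 ++ x :: u2) = n ->
  word (perm_word (u1 ++ (c *: x + y) :: u2) s) =
  c *: word (perm_word (u1 ++ x :: u2) s) + word (perm_word (u1 ++ y :: u2) s).
Proof.
rewrite size_cat /= => sz; have lt_n : (size u1 < n)%N by rewrite -sz -addSnnS leq_addr.
pose j := Ordinal lt_n; have := mem_enum 'I_n (s j); rewrite inE /perm_word /image_mem.
move: (enum 'I_n) (enum_uniq 'I_n) => enum_n enum_uniq ej; move: enum_uniq.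
case/splitPr: ej => e1 e2; rewrite cat_uniq /= => /and3P[_ /norP[j1 _] /andP[j2 _]].
have nthj z : (u1 ++ z :: u2)`_((s^-1)%g (s j)) = z.
  by rewrite permK /= nth_cat ltnn subnn.
have nthE z z' (e : seq 'I_n) : s j \notin e ->
    [seq (u1 ++ z :: u2)`_((s^-1)%g i) | i <- e] =
    [seq (u1 ++ z' :: u2)`_((s^-1)%g i) | i <- e].
  move=> je; apply/eq_in_map => i ie; rewrite !nth_cat; case: ltnP => // le_i.
  case E: (_ - _)%N => [|m] //=; case/negP: je; suff -> : s j = i by [].
  rewrite -[i](permKV s); congr (s _); apply: val_inj; apply/eqP => /=.
  by rewrite eqn_leq le_i -subn_eq0 E.
rewrite !map_cat /= !nthj word_multilinear.
by rewrite !(nthE _ 0 e1) ?(nthE _ 0 e2).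
Qed.

Section Ops.
Variables (a b : nat -> nat -> nat) (l r : bool).

Lemma shuffle_multilinearl v : multilinear (shuffle_word a b l r ^~ v).
Proof.
move=> s t c x y; rewrite /shuffle_word; have E z : (s ++ z :: t == [::]) = false by case: s.
rewrite !E; case: ifP => _; first by rewrite word_multilinear mulrnDl scalerMnr.
rewrite !size_cat /= scaler_sumr -big_split; apply: eq_bigr => g _.
by rewrite -!catA !cat_cons; apply: perm_word_multilinear; rewrite !size_cat /= size_cat; lia.
Qed.

Lemma shuffle_multilinearr u : multilinear (shuffle_word a b l r u).
Proof.
move=> s t c x y; rewrite /shuffle_word; have E z : (s ++ z :: t == [::]) = false by case: s.
rewrite !E; case: ifP => _; first by rewrite word_multilinear mulrnDl scalerMnr.
rewrite !size_cat /= scaler_sumr -big_split; apply: eq_bigr => g _.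
by rewrite !catA; apply: perm_word_multilinear; rewrite !size_cat addnA.
Qed.

Definition shuffle_op : H -> H -> H := tens_ext2 (shuffle_word a b l r).

Lemma shuffle_op_bilin : bilin shuffle_op.
Proof.
split=> [v|u]; [apply: tens_ext2_linearl|apply: tens_ext2_linearr];
  by [exact: shuffle_multilinearl|exact: shuffle_multilinearr].
Qed.

Lemma shuffle_op_word u v :
  shuffle_op (word u) (word v) = shuffle_word a b l r u v.
Proof.
apply: tens_ext2_word; [exact: shuffle_multilinearl|exact: shuffle_multilinearr].
Qed.

End Ops.

(* The compass directions are those of the usual arrows for the four
   operations. *)
Definition quad_SE : H -> H -> H :=
  shuffle_op (fun p q => p) (fun p q => (p + q).-1) true false.
Definition quad_NE : H -> H -> H :=
  shuffle_op (fun p q => p) (fun p q => p.-1) false false.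
Definition quad_NW : H -> H -> H :=
  shuffle_op (fun p q => 0%N) (fun p q => p.-1) false true.
Definition quad_SW : H -> H -> H :=
  shuffle_op (fun p q => 0%N) (fun p q => (p + q).-1) false false.

Definition quad_succ (x y : H) : H := quad_NE x y + quad_SE x y.
Definition quad_prec (x y : H) : H := quad_NW x y + quad_SW x y.
Definition quad_vee (x y : H) : H := quad_SE x y + quad_SW x y.
Definition quad_wedge (x y : H) : H := quad_NE x y + quad_NW x y.

Lemma bilinD (f g : H -> H -> H) : bilin f -> bilin g -> bilin (fun x y => f x y + g x y).
Proof.
move=> Bf Bg; split=> y a x x'; first by rewrite Bf.1 Bg.1 scalerDr addrACA.
by rewrite Bf.2 Bg.2 scalerDr addrACA.
Qed.

Lemma bilin_summand (f g : H -> H -> H) v w :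
  bilin f -> bilin g -> bilin (fun x y => f x v * g y w).
Proof.
move=> Bf Bg; split=> y a x x'; first by rewrite Bf.1 mulrDl scalerAl.
by rewrite Bg.1 mulrDr scalerAr.
Qed.

Lemma shuffle_op_pos a b l r x y : tens_pos y -> tens_pos (shuffle_op a b l r x y).
Proof.
have [Bl Br] := shuffle_op_bilin a b l r.
elim=> [|c _ t [v v0 ->] _ IH]; first by rewrite (lin_map0 (Br x)); exact: lspan0.
rewrite Br; apply: lspanD => //; apply: lspanZ => {IH}.
elim/tens_ind: x => [|d u x IH]; first by rewrite (lin_map0 (Bl _)); exact: lspan0.
rewrite Bl; apply: lspanD => //; apply: lspanZ => {IH}.
have Pw (w : seq V) : w != [::] -> tens_pos (word w).
  move=> w0; rewrite -[word w]addr0 -[word w]scale1r.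
  by apply: lspanP; [exists w|exact: lspan0].
have PM (w : seq V) (c' : bool) : w != [::] -> tens_pos (word w *+ c').
  by case: c' => w0; rewrite ?mulr1n ?mulr0n; [exact: Pw|exact: lspan0].
rewrite shuffle_op_word /shuffle_word (negPf v0); case: ifP => [_|/negbT u0].
  exact: PM.
elim/big_ind: _ => [|z1 z2|s _]; [exact: lspan0|exact: lspanD|].
apply: Pw; rewrite -size_eq0 size_image card_ord addn_eq0 !size_eq0.
by rewrite (negPf u0).
Qed.

Lemma tens_posM (x y : H) : tens_pos x -> tens_pos y -> tens_pos (x * y).
Proof.
move=> Px Py; elim: Px => [|a _ z [u u0 ->] _ IH]; first by rewrite mul0r; exact: lspan0.
rewrite mulrDl -scalerAl; apply: lspanD => //; apply: lspanZ => {IH z}.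
elim: Py => [|b _ t [v v0 ->] _ IH]; first by rewrite mulr0; exact: lspan0.
rewrite mulrDr -scalerAr; apply: lspanD => //; apply: lspanZ => {IH t}.
rewrite wordM -[word _]addr0 -[word _]scale1r; apply: lspanP; last exact: lspan0.
by exists (u ++ v); rewrite // -size_eq0 size_cat addn_eq0 !size_eq0 (negPf u0).
Qed.

End Shuffles.

Notation "x \SE y" := (quad_SE x y) (at level 40, left associativity) : ring_scope.
Notation "x \NE y" := (quad_NE x y) (at level 40, left associativity) : ring_scope.
Notation "x \NW y" := (quad_NW x y) (at level 40, left associativity) : ring_scope.
Notation "x \SW y" := (quad_SW x y) (at level 40, left associativity) : ring_scope.
Notation "x \succ y" := (quad_succ x y) (at level 40, left associativity) : ring_scope.
Notation "x \prec y" := (quad_prec x y) (at level 40, left associativity) : ring_scope.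
Notation "x \vee y" := (quad_vee x y) (at level 40, left associativity) : ring_scope.
Notation "x \wedge y" := (quad_wedge x y) (at level 40, left associativity) : ring_scope.

Notation "\dec_ ( x , y <- u ) E" := (deconc_sum u (fun x y => E))
  (at level 41, x name, y name, u at level 36, E at level 41, right associativity,
   format "\dec_ ( x ,  y  <-  u )  E") : ring_scope.

(* Main.v *)
(* A shuffle of u and v w is cut in two either right after the last letter of v
   or right before the first letter of w. In both cases the left part is a
   shuffle of a prefix u^1 of u with v, the right part a shuffle of the remaining
   suffix u^2 with w; the first letter of the whole is that of the left part, its
   last letter that of the right part. The first cut forces the left part to end
   in v and the second one forces the right part to start in w, and each cut
   recovers every shuffle exactly once.

   Shuffles are encoded by the bit sequences recording which letters come from
   u; summing over these by induction on their length gives a recursion on the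
   first letter, from which both decompositions follow by induction on v and u. *)
Require Import Defs.
From mathcomp Require Import all_boot all_algebra.
From mathcomp Require Import all_fingroup zify.

Set Implicit Arguments.
Unset Strict Implicit.
Unset Printing Implicit Defensive.

Import GRing.Theory.
Local Open Scope ring_scope.

(** * Ranks of the letters in a shuffle encoded by bits *)

(* The letter number that the shuffle encoded by m puts in position i: a bit is
   true when the letter comes from the first word, which has length p. *)
Definition mask_rank (p : nat) (m : bitseq) (i : nat) : nat :=
  if nth false m i then count id (take i m)
  else (p + count negb (take i m))%N.

Lemma count_take_lt (T : Type) (x0 : T) (a : pred T) s i j :
  (i < j)%N -> (j <= size s)%N -> a (nth x0 s i) ->
  (count a (take i s) < count a (take j s))%N.
Proof.
move=> ij js ai; have is_ : (i < size s)%N by lia.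
rewrite -(subnKC ij) takeD count_cat (take_nth x0) // -cats1 count_cat /= ai; lia.
Qed.

Lemma mask_rank_lt p m i j : (i < j)%N -> (j < size m)%N ->
  nth false m i = nth false m j -> (mask_rank p m i < mask_rank p m j)%N.
Proof.
move=> ij jm eij; rewrite /mask_rank -eij; case: ifP => mi.
  by apply: (@count_take_lt _ false id) => //; exact: ltnW.
by rewrite ltn_add2l (@count_take_lt _ false negb) ?mi //; exact: ltnW.
Qed.

Lemma mask_rank_ltp p m i : count id m = p -> (i < size m)%N ->
  (mask_rank p m i < p)%N = nth false m i.
Proof.
move=> mp im; rewrite /mask_rank; case: ifP => mi; last by lia.
by rewrite -mp -{2}(take_size m); apply: (@count_take_lt _ false).
Qed.

Lemma count_negb m : count negb m = (size m - count id m)%N.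
Proof. by rewrite -(count_predC id m) addKn. Qed.

Lemma mask_rank_lt_size p m i : count id m = p -> (i < size m)%N ->
  (mask_rank p m i < size m)%N.
Proof.
move=> mp im; have pm : (p <= size m)%N by rewrite -mp count_size.
have := mask_rank_ltp mp im; rewrite /mask_rank; case: ifP => mi lt_p.
  exact: leq_trans lt_p pm.
have : (count negb (take i m) < count negb (take (size m) m))%N.
  by apply: (@count_take_lt _ false); rewrite ?mi.
by rewrite take_size (count_negb m) mp; lia.
Qed.

(** The rank tells the bit, by comparison with [p], and at positions with equal bits it is strictly
    increasing. *)
Lemma mask_rank_inj p m i j : count id m = p ->
  (i < size m)%N -> (j < size m)%N -> mask_rank p m i = mask_rank p m j -> i = j.
Proof.
move=> mp im jm e; have mij : nth false m i = nth false m j.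
  by rewrite -!(mask_rank_ltp mp) // e.
case: (ltngtP i j) => // [ij|ji].
- by have := mask_rank_lt p ij jm mij; rewrite e ltnn.
- by have := mask_rank_lt p ji im (esym mij); rewrite e ltnn.
Qed.

Lemma mask_rank_head p m : (0 < size m)%N ->
  mask_rank p m 0 = if head false m then 0%N else p.
Proof. by case: m => // -[] m _; rewrite /mask_rank /= ?addn0. Qed.

Lemma mask_rank_last p m n : count id m = p -> size m = n.+1 ->
  mask_rank p m n = if last false m then p.-1 else n.
Proof.
case/lastP: m => // m x; rewrite size_rcons => mp [mn].
rewrite /mask_rank -cats1 last_cat nth_cat take_cat mn ltnn subnn /= cats0.
rewrite -cats1 count_cat /= in mp.
by case: x mp => mp; rewrite ?count_negb; have := count_size id m; lia.
Qed.

(** Gaps never shrink: [h i + d <= h (i + d)]. Starting from position 0 this gives [i <= h i],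
    ending at the last one it gives [h i <= i]. *)
Lemma ord_incr_id n (h : 'I_n -> nat) : (forall i, (h i < n)%N) ->
  (forall i j : 'I_n, (i < j)%N -> (h i < h j)%N) -> forall i, h i = i.
Proof.
move=> h_n h_incr; have hD d (i j : 'I_n) : (i + d)%N = j -> (h i + d <= h j)%N.
  elim: d j => [|d IH] j ij.
    by rewrite addn0; suff -> : i = j by []; apply: val_inj; rewrite /= -ij addn0.
  have ltn : (i + d < n)%N by have := ltn_ord j; lia.
  have := IH (Ordinal ltn) erefl; have := h_incr (Ordinal ltn) j.
  by rewrite /= -ij; lia.
case: n h h_n h_incr hD => [|n] h h_n _ hD i; first by case: i.
have := hD i ord0 i (add0n _); have := hD (n - i)%N i ord_max.
by have := h_n ord_max; have := ltn_ord i; rewrite /=; lia.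
Qed.

(** * The bijection between shuffles and bit sequences *)

Section ShuffleMask.
Variables p q : nat.
Local Notation n := (p + q)%N.

Definition shuffle_mask (s : 'S_n) : n.-tuple bool :=
  [tuple ((s^-1)%g i < p)%N | i < n].

Lemma nth_shuffle_mask s (i : 'I_n) :
  nth false (shuffle_mask s) i = ((s^-1)%g i < p)%N.
Proof. by rewrite -tnth_nth tnth_mktuple. Qed.

Lemma ShP (s : 'S_n) (i j : 'I_n) : s \in Sh p q ->
  (j < p)%N || (p <= i)%N -> (i < j)%N -> (s i < s j)%N.
Proof.
by rewrite inE => /forallP/(_ i)/forallP/(_ j)/implyP sh ijp ij; apply: sh; rewrite ij.
Qed.

Lemma count_shuffle_mask s : count id (shuffle_mask s) = p.
Proof.
rewrite count_map -sum1_count big_enum_cond /= (reindex s) /=; last first.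
  by exists (s^-1)%g => i _; rewrite ?permK ?permKV.
under eq_bigl => i do rewrite permK.
by rewrite -(@big_ord_widen _ _ _ p n (fun=> 1%N)) ?leq_addr // sum1_card card_ord.
Qed.

(** The rank composed with [s] is strictly increasing, hence the identity: within a word because [s]
    is a shuffle, across the words because exactly the letters of the first one have rank below
    [p]. *)
Lemma shuffle_mask_rank s (i : 'I_n) : s \in Sh p q ->
  (s^-1)%g i = mask_rank p (shuffle_mask s) i :> nat.
Proof.
move=> sS; pose h j := mask_rank p (shuffle_mask s) (s j).
suff /(_ ((s^-1)%g i)): forall j, h j = j :> nat by rewrite /h permKV => <-.
have cp := count_shuffle_mask s.
have h_n j : (h j < n)%N.
  by rewrite -[X in (_ < X)%N](size_tuple (shuffle_mask s)) mask_rank_lt_size ?size_tuple.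
have h_p j : (h j < p)%N = (j < p)%N.
  by rewrite mask_rank_ltp ?size_tuple // nth_shuffle_mask permK.
apply: ord_incr_id h_n _ => j l jl; have [lp|pl] := ltnP l p; last first.
  have [jp|pj] := ltnP j p; first by apply: leq_trans (_ : (p <= _)%N); [rewrite h_p | rewrite leqNgt h_p -leqNgt].
  apply: mask_rank_lt; rewrite ?size_tuple //; first by apply: ShP; rewrite ?pj ?orbT.
  by rewrite !nth_shuffle_mask !permK ltnNge pj ltnNge pl.
apply: mask_rank_lt; rewrite ?size_tuple //; first by apply: ShP; rewrite ?lp.
by rewrite !nth_shuffle_mask !permK lp (ltn_trans jl lp).
Qed.

Lemma shuffle_mask_inj : {in Sh p q &, injective shuffle_mask}.
Proof.
move=> s t sS tS est; apply: invg_inj; apply/permP => i; apply: val_inj => /=.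
by rewrite !shuffle_mask_rank // est.
Qed.

Lemma shuffle_mask_surj (m : n.-tuple bool) : count id m = p ->
  exists2 s, s \in Sh p q & shuffle_mask s = m.
Proof.
move=> mp; have lt_n (i : 'I_n) : (mask_rank p m i < n)%N.
  by rewrite -[X in (_ < X)%N](size_tuple m) mask_rank_lt_size // size_tuple.
pose f i := Ordinal (lt_n i); have f_inj : injective f.
  move=> i j [/(mask_rank_inj mp)]; rewrite size_tuple => e.
  exact/val_inj/e.
have fE i : perm f_inj i = mask_rank p m i :> nat by rewrite permE.
(* The shuffle is the inverse of the rank. An inversion inside one word would contradict the growth
   of ranks at equal bits. *)
exists (perm f_inj)^-1%g.
  rewrite inE; apply/forallP => i; apply/forallP => j; apply/implyP => /andP[ij ijp].
  set s := (_^-1)%g; rewrite ltnNge leq_eqVlt; apply/negP => /orP[/eqP/val_inj|].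
    by move=> /perm_inj e; rewrite e ltnn in ij.
  have sE l : mask_rank p m (s l) = l :> nat by rewrite -fE permKV.
  have sT l : nth false m (s l) = (l < p)%N.
    by rewrite -(mask_rank_ltp mp) ?size_tuple // sE.
  move=> /(@mask_rank_lt p m); rewrite size_tuple !sE !sT => /(_ (ltn_ord _)).
  by lia.
apply/eq_from_tnth => i; rewrite tnth_mktuple invgK fE mask_rank_ltp ?size_tuple //.
exact/esym/tnth_nth.
Qed.

End ShuffleMask.

(** As [p] and [q] are positive, [0 <> p] and [p.-1 <> (p + q).-1], so the letter number at each end
    determines its bit. *)
Lemma Sh_ends_mask p q (s : 'S_(p + q)) (x y : bool) : (0 < p + q)%N ->
  (0 < p)%N -> (0 < q)%N ->
  (s \in Sh_ends p q (if x then 0%N else p) (if y then p.-1 else (p + q).-1)) =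
  [&& s \in Sh p q, head false (shuffle_mask s) == x
                  & last false (shuffle_mask s) == y].
Proof.
move=> n_gt0 p_gt0 q_gt0; rewrite [LHS]inE; case sS: (s \in Sh p q) => //=.
pose i0 := Ordinal n_gt0.
have lt_n : ((p + q).-1 < p + q)%N by rewrite prednK.
pose i1 := Ordinal lt_n; have sz := size_tuple (shuffle_mask s).
have E0 : (s^-1)%g i0 = (if head false (shuffle_mask s) then 0%N else p) :> nat.
  by rewrite shuffle_mask_rank // mask_rank_head ?sz.
have E1 : (s^-1)%g i1 = (if last false (shuffle_mask s) then p.-1 else (p + q).-1) :> nat.
  by rewrite shuffle_mask_rank // (mask_rank_last (count_shuffle_mask s)) ?sz ?prednK.
have -> : (head false (shuffle_mask s) == x) =
    ((s^-1)%g i0 == (if x then 0%N else p) :> nat).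
  by rewrite E0; case: (head _ _); case: x => /=; lia.
have -> : (last false (shuffle_mask s) == y) =
    ((s^-1)%g i1 == (if y then p.-1 else (p + q).-1) :> nat).
  by rewrite E1; case: (last _ _); case: y => /=; lia.
apply/forallP/andP => [sE|[e0 e1] i].
  by have /andP[/implyP-> //] := sE i0; have /andP[_ /implyP->] := sE i1; rewrite ?prednK.
apply/andP; split; apply/implyP => /eqP iE.
  by rewrite (_ : i = i0) //; apply: val_inj.
by rewrite (_ : i = i1) //; apply: val_inj => /=; lia.
Qed.

(** * Sums of shuffles by recursion on the first letter *)

Lemma big_tuple_cons (R : nmodType) (T : finType) n (P : pred (seq T)) (F : seq T -> R) :
  \sum_(m : n.+1.-tuple T | P m) F m =
  \sum_(x : T) \sum_(m : n.-tuple T | P (x :: m)) F (x :: m).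
Proof.
rewrite pair_big_dep /= (reindex (fun z : T * n.-tuple T => [tuple of z.1 :: z.2])) //=.
exists (fun m : n.+1.-tuple T => (thead m, [tuple of behead m])) => m _ /=.
  by case: m => x m /=; congr (_, _); apply: val_inj.
by rewrite -tuple_eta.
Qed.

Section Words.
Variables (k : fieldType) (V : lmodType k).
Local Notation H := (tensalg V).
Implicit Types (u v w : seq V) (m : bitseq).

(** An exhausted word supplies 0, the default of indexing, so that the two agree for any bits. *)
Fixpoint mask_merge m u v : seq V :=
  match m with
  | [::] => [::]
  | true :: m' => head 0 u :: mask_merge m' (behead u) v
  | false :: m' => head 0 v :: mask_merge m' u (behead v)
  end.

Lemma size_mask_merge m u v : size (mask_merge m u v) = size m.
Proof. by elim: m u v => [|[] m IH] u v //=; rewrite IH. Qed.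

Lemma nth_mask_merge m u v i : (i < size m)%N ->
  (mask_merge m u v)`_i = if nth false m i then u`_(count id (take i m))
                          else v`_(count negb (take i m)).
Proof.
elim: m u v i => [|x m IH] u v [|i] //=; first by case: x => /=; rewrite nth0.
by case: x => /= im; rewrite IH // nth_behead ?add0n ?add1n.
Qed.

Lemma perm_word_merge u v (s : 'S_(size u + size v)) : s \in Sh (size u) (size v) ->
  perm_word (u ++ v) s = mask_merge (shuffle_mask s) u v.
Proof.
move=> sS; apply: (@eq_from_nth _ 0).
  by rewrite size_map size_mask_merge size_tuple size_enum_ord.
rewrite size_map size_enum_ord => i lt_i; pose j := Ordinal lt_i.
rewrite (nth_map j) ?size_enum_ord // (_ : nth j _ _ = j); last first.
  by apply: val_inj; rewrite /= nth_enum_ord.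
rewrite nth_mask_merge ?size_tuple // nth_cat shuffle_mask_rank //.
rewrite mask_rank_ltp ?size_tuple ?count_shuffle_mask // /mask_rank /=.
by case: ifP => ->; rewrite ?addKn.
Qed.

(* The sum of the shuffles of u and v whose last letter comes from u if and
   only if y holds. The bit c stands for the origin of the letter preceding
   u and v; it matters only when both words are empty. *)
Fixpoint shuf (y c : bool) u : seq V -> H :=
  match u with
  | [::] => fun v => if v is [::] then (c == y)%:R else word v *+ ~~ y
  | a :: u' => fix shuf_cons v :=
      word [:: a] * shuf y true u' v +
      (if v is b :: v' then word [:: b] * shuf_cons v' else 0)
  end.

(* The part of shuf y c u v where the first letter comes from u if and only if
   x holds. *)
Definition shuf_first (x y : bool) u v : H :=
  if x then (if u is a :: u' then word [:: a] * shuf y true u' v else 0)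
  else (if v is b :: v' then word [:: b] * shuf y false u v' else 0).

Lemma word_cons (a : V) u : word [:: a] * word u = word (a :: u).
Proof. exact: wordM. Qed.

Lemma shuf_nil y v : shuf y false [::] v = word v *+ ~~ y.
Proof. by case: v => //=; case: y. Qed.

Lemma shuf_firstE y c u v : (0 < size u + size v)%N ->
  shuf y c u v = shuf_first true y u v + shuf_first false y u v.
Proof.
case: u => [|a u]; case: v => [|b v] // _.
by rewrite /shuf_first shuf_nil add0r mulrnAr word_cons.
Qed.

Definition mask_sum n (y c : bool) u v : H :=
  \sum_(m : n.-tuple bool | (count id m == size u) && (last c m == y))
     word (mask_merge m u v).

(** Serves both the induction in [mask_sum_shuf] and the fixed first bit in [Sh_ends_sum]. The bit
    [x] becomes the preceding bit for the remaining letters. *)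
Lemma mask_sum_cons n x y c u v :
  (forall c u v, n = (size u + size v)%N -> mask_sum n y c u v = shuf y c u v) ->
  n.+1 = (size u + size v)%N ->
  \sum_(m : n.-tuple bool | (count id (x :: m) == size u) && (last c (x :: m) == y))
     word (mask_merge (x :: m) u v) = shuf_first x y u v.
Proof.
move=> IH sz; case: x => /=.
- case: u sz => [|a u] /= sz; first by rewrite big_pred0.
  under eq_bigr => m _ do rewrite -word_cons.
  by rewrite -mulr_sumr -IH //; lia.
case: v sz => [|b v] /= sz.
  (* Here [u] has [n + 1] letters, too many for the [n] bits of [m]. *)
  rewrite big_pred0 // => m; apply/negP => /andP[/eqP cm _].
  by have := count_size id m; rewrite size_tuple; lia.
under eq_bigr => m _ do rewrite -word_cons.
by rewrite -mulr_sumr -IH //; lia.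
Qed.

Lemma mask_sum_shuf n y c u v : n = (size u + size v)%N ->
  mask_sum n y c u v = shuf y c u v.
Proof.
elim: n c u v => [|n IH] c u v sz.
  case: u v sz => [|//] [|//] _; rewrite /mask_sum /=.
  case: eqP => cy.
    rewrite (big_pred1 [tuple]) ?tuple0 //= => m.
    by rewrite !tuple0 /= eqxx cy eqxx.
  by rewrite big_pred0 // => m; rewrite !tuple0 /=; apply/eqP.
rewrite /mask_sum (big_tuple_cons n (fun m => (count id m == size u) && (last c m == y))
  (fun m => word (mask_merge m u v))) big_bool.
by rewrite !mask_sum_cons //; apply/esym/shuf_firstE; rewrite -sz.
Qed.

(** The bijection turns prescribed ends into conditions on the first and last bits; in the split on
    the first bit only [x] survives. *)
Lemma Sh_ends_sum x y u v : u != [::] -> v != [::] ->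
  \sum_(s in Sh_ends (size u) (size v) (if x then 0%N else size u)
              (if y then (size u).-1 else (size u + size v).-1))
     word (perm_word (u ++ v) s) = shuf_first x y u v.
Proof.
rewrite -!size_eq0 -!lt0n => u0 v0.
have uv0 : (0 < size u + size v)%N by rewrite addn_gt0 u0.
set A := Sh_ends _ _ _ _.
have AE s : (s \in A) = _ := Sh_ends_mask s x y uv0 u0 v0.
have AS s : s \in A -> s \in Sh (size u) (size v) by rewrite AE => /andP[].
under eq_bigr => s /AS sS do rewrite perm_word_merge //.
rewrite -(big_imset (fun m : _.-tuple bool => word (mask_merge m u v))) /=; last first.
  by move=> s t /AS sS /AS tS; exact: shuffle_mask_inj.
transitivity (\sum_(m : (size u + size v).-tuple bool |
    [&& count id m == size u, head false m == x & last false m == y])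
  word (mask_merge m u v)).
  apply: eq_bigl => m; apply/imsetP/and3P => [[s sA ->]|[/eqP cm hm lm]].
    by move: sA; rewrite AE => /and3P[_ -> ->]; rewrite count_shuffle_mask.
  have [s sS sm] := shuffle_mask_surj cm.
  by exists s; rewrite // AE sS sm hm.
move: uv0; case E: (size u + size v)%N => [//|n] _.
rewrite (big_tuple_cons n (fun m => [&& count id m == size u, head false m == x &
  last false m == y]) (fun m => word (mask_merge m u v))).
rewrite (bigD1 x) //= [X in _ + X]big1 ?addr0 => [|z /negPf zx].
  under eq_bigl => m do rewrite eqxx /=.
  by apply: (@mask_sum_cons n x y false) => // c' u' v'; exact: mask_sum_shuf.
by rewrite big_pred0 // => m; rewrite zx andbF.
Qed.

(** * The four operations on words *)

(* x and y tell whether the first and the last letter come from the left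
   operand, so that NW, NE, SW and SE are given by (x, y) = (1, 1), (0, 1),
   (1, 0) and (0, 0). *)
Definition quad (x y : bool) : H -> H -> H :=
  @shuffle_op k V (fun p q => if x then 0%N else p)
    (fun p q => if y then p.-1 else (p + q).-1) (~~ x && ~~ y) (x && y).

Lemma quad_word x y u v : v != [::] ->
  quad x y (word u) (word v) = shuf_first x y u v.
Proof.
move=> v0; rewrite /quad shuffle_op_word /shuffle_word (negPf v0).
have [->|u0] := eqVneq u [::]; last exact: Sh_ends_sum.
case: v v0 => // b v _; case: x => //.
by rewrite /shuf_first shuf_nil mulrnAr word_cons.
Qed.

(** * Convolution for the deconcatenation, and the two cuts *)

Definition conv (f g : seq V -> H) u : H :=
  \sum_(i < (size u).+1) f (take i u) * g (drop i u).

Lemma conv_nil f g : conv f g [::] = f [::] * g [::].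
Proof. by rewrite /conv big_ord1. Qed.

Lemma conv_cons f g a u :
  conv f g (a :: u) = f [::] * g (a :: u) + conv (fun u' => f (a :: u')) g u.
Proof. by rewrite /conv big_ord_recl. Qed.

Lemma convDl f f' g u : conv (fun u' => f u' + f' u') g u = conv f g u + conv f' g u.
Proof. by rewrite -big_split; apply: eq_bigr => i _; rewrite mulrDl. Qed.

Lemma convMl h f g u : conv (fun u' => h * f u') g u = h * conv f g u.
Proof. by rewrite mulr_sumr; apply: eq_bigr => i _; rewrite mulrA. Qed.

Lemma conv0l f g u : f =1 (fun=> 0) -> conv f g u = 0.
Proof. by move=> f0; apply: big1 => i _; rewrite f0 mul0r. Qed.

Definition shuf_all (c : bool) u v : H := shuf true c u v + shuf false c u v.

(* Common to shuf false and shuf_all, the left factors of the two cuts. *)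
Definition shuf_rec (f : bool -> seq V -> seq V -> H) : Prop :=
  (forall c b v, f c [::] (b :: v) = word (b :: v)) /\
  (f false [::] [::] = 1) /\
  (forall c a b u v, f c (a :: u) (b :: v) =
     word [:: a] * f true u (b :: v) + word [:: b] * f false (a :: u) v).

Lemma shuf_rec_false : shuf_rec (shuf false).
Proof. by []. Qed.

Lemma shuf_rec_all : shuf_rec shuf_all.
Proof.
split=> [c b v|]; first by rewrite /shuf_all /= mulr0n mulr1n add0r.
split=> [|c a b u v]; first by rewrite /shuf_all /= add0r.
by rewrite /shuf_all 2!mulrDr addrACA.
Qed.

(* Given a decomposition of the shuffles of u with w, the letters of v are put
   in front of w one at a time: the first letter of a shuffle of u and v w,
   with v nonempty, is the first letter of the left factor. *)
Lemma shuf_conv f g y w : shuf_rec f ->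
  (forall u, shuf y false u w = conv (f false ^~ [::]) g u) ->
  forall v c u, v != [::] \/ c = false ->
  shuf y c u (v ++ w) = conv (f c ^~ v) g u.
Proof.
move=> [f0 [f1 fS]] base; have g0 : g [::] = word w *+ ~~ y.
  by rewrite -shuf_nil base conv_nil f1 mul1r.
have f0r v : f false [::] v = word v by case: v.
elim=> [c u [//|->]|b v IHv c u _]; first exact: base.
elim: u c => [|a u IHu] c.
  by rewrite conv_nil f0 g0 mulrnAr wordM.
rewrite -[LHS]/(word [:: a] * shuf y true u ((b :: v) ++ w) +
                word [:: b] * shuf y false (a :: u) (v ++ w)).
(* Removing [b] may leave [v] empty, but the preceding bit is then [false], as [IHv] requires. *)
rewrite IHu IHv; last by right.
rewrite !conv_cons f0 f0r mulrDr mulrA word_cons addrCA; congr (_ + _).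
rewrite -!convMl -convDl; apply: eq_bigr => i _; congr (_ * _); exact/esym/fS.
Qed.

Lemma shuf_nilr y u : shuf y true u [::] = word u *+ y.
Proof.
elim: u => [|a u IHu] /=; first by case: y.
by rewrite addr0 IHu mulrnAr word_cons.
Qed.

(** When [v] is empty, a nonempty prefix of [u] cannot end in [v], so only the empty prefix
    contributes. *)
Lemma shuf_cut_last y c u v w : v != [::] \/ c = false ->
  shuf y c u (v ++ w) = conv (shuf false c ^~ v) (shuf y false ^~ w) u.
Proof.
apply: shuf_conv; first exact: shuf_rec_false.
case=> [|a t]; first by rewrite conv_nil mul1r.
rewrite conv_cons mul1r conv0l ?addr0 // => t' /=.
by rewrite shuf_nilr mulr0n mulr0 addr0.
Qed.

(** When [v] is empty, the left factor consists of the letters of [u] that precede the first letter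
    of [w]. *)
Lemma shuf_cut_first y c u v w : v != [::] \/ c = false -> w != [::] ->
  shuf y c u (v ++ w) = conv (shuf_all c ^~ v) (shuf_first false y ^~ w) u.
Proof.
move=> vc w0; have all1 c' : shuf_all c' [::] [::] = 1.
  by rewrite /shuf_all /=; case: c'; rewrite ?addr0 ?add0r.
(* The bit varies because removing a letter of [t] sets it to [true]. *)
have base c' t : shuf y c' t w =
    conv (shuf_all c' ^~ [::]) (shuf_first false y ^~ w) t.
  elim: t c' => [|a t IHt] c'.
    by rewrite conv_nil all1 mul1r shuf_firstE ?[LHS]add0r // lt0n size_eq0.
  rewrite conv_cons all1 mul1r shuf_firstE // addrC; congr (_ + _).
  rewrite /shuf_first IHt -convMl; apply: eq_bigr => i _; congr (_ * _).
  by rewrite /shuf_all /= !addr0 mulrDr.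
by move: v c u vc; apply: shuf_conv; [exact: shuf_rec_all|exact: base].
Qed.

(** Removing the first letter leaves the bit [true] with [v] still nonempty, or the bit [false] with
    a possibly empty rest of [v]; hence the disjunction. *)
Lemma shuf_first_conv x y f g u v w : v != [::] ->
  (forall c u v, v != [::] \/ c = false ->
    shuf y c u (v ++ w) = conv (f c ^~ v) g u) ->
  shuf_first x y u (v ++ w) =
  conv (fun t => if x then if t is a :: t' then word [:: a] * f true t' v else 0
                 else if v is b :: v' then word [:: b] * f false t v' else 0) g u.
Proof.
move=> v0 shufE; case: x; last first.
  case: v v0 => // b v _; rewrite convMl -shufE //; by right.
case: u => [|a u]; first by rewrite conv_nil mul0r.
by rewrite conv_cons mul0r add0r convMl -shufE //; left.
Qed.

Lemma quad_cut_last x y u v w : v != [::] -> w != [::] ->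
  quad x y (word u) (word v * word w) =
  \dec_(u1, u2 <- word u)
    (quad x false u1 (word v) * (quad false y u2 (word w) + quad true y u2 (word w))).
Proof.
move=> v0 w0; rewrite deconc_sum_word; last first.
  apply: (@bilin_summand _ _ (quad x false)
            (fun s t => quad false y s t + quad true y s t)).
    exact: shuffle_op_bilin.
  by apply: bilinD; exact: shuffle_op_bilin.
rewrite wordM quad_word; last by case: (v) v0.
rewrite (@shuf_first_conv x y (shuf false) (shuf y false ^~ w)) //; last first.
  by move=> c u' v' vc; exact: shuf_cut_last.
apply: eq_bigr => i _; rewrite !quad_word // addrC -(shuf_firstE _ false) //.
by rewrite addn_gt0 orbC lt0n size_eq0 w0.
Qed.

Lemma quad_cut_first x y u v w : v != [::] -> w != [::] ->
  quad x y (word u) (word v * word w) =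
  \dec_(u1, u2 <- word u)
    ((quad x true u1 (word v) + quad x false u1 (word v)) * quad false y u2 (word w)).
Proof.
move=> v0 w0; rewrite deconc_sum_word; last first.
  apply: (@bilin_summand _ _ (fun s t => quad x true s t + quad x false s t)
            (quad false y)); last exact: shuffle_op_bilin.
  by apply: bilinD; exact: shuffle_op_bilin.
rewrite wordM quad_word; last by case: (v) v0.
rewrite (@shuf_first_conv x y shuf_all (shuf_first false y ^~ w)) //; last first.
  by move=> c u' v' vc; exact: shuf_cut_first.
apply: eq_bigr => i _; rewrite !quad_word //; congr (_ * _).
(* Adding over the last letter of the left factor turns [shuf] into [shuf_all] behind the first
   letter. *)
case: x; first by case: (take i u) => [|a t]; rewrite /shuf_first ?addr0 // mulrDr.
by case: v v0 => // b v _; rewrite mulrDr.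
Qed.

End Words.

(** * From words to tensors by linearity *)

Lemma tens_pos_ind (k : fieldType) (V M : lmodType k) (f g : tensalg V -> M) :
  linear f -> linear g -> (forall u, u != [::] -> f (word u) = g (word u)) ->
  forall x, tens_pos x -> f x = g x.
Proof.
move=> fL gL fg x; elim=> [|a _ y [u u0 ->] _ IH].
  by rewrite (lin_map0 fL) (lin_map0 gL).
by rewrite fL gL fg // IH.
Qed.

Lemma deconc_sum_linear_param (k : fieldType) (V N M : lmodType k)
    (B : N -> tensalg V -> tensalg V -> M) :
  (forall z, bilin (B z)) -> (forall x y, linear (fun z => B z x y)) ->
  forall u, linear (fun z => \dec_(u1, u2 <- u) B z u1 u2).
Proof.
move=> Bb BL u a z z'; move: u; apply: tens_lin_eq.
- exact/deconc_sum_linear.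
- move=> b u u'; rewrite !deconc_sum_linear //.
  by rewrite !scalerDr !scalerA mulrC addrACA.
move=> u; rewrite !deconc_sum_word // scaler_sumr -big_split.
by apply: eq_bigr => i _; exact: BL.
Qed.

Lemma quad_mul_dec (k : fieldType) (V : lmodType k) x y
    (f g : tensalg V -> tensalg V -> tensalg V) : bilin f -> bilin g ->
  (forall u v w, v != [::] -> w != [::] ->
    quad x y (word u) (word v * word w) =
    \dec_(u1, u2 <- word u) (f u1 (word v) * g u2 (word w))) ->
  forall u v w, tens_pos v -> tens_pos w ->
  quad x y u (v * w) = \dec_(u1, u2 <- u) (f u1 v * g u2 w).
Proof.
move=> fB gB E u v w v_pos w_pos.
have qB : bilin (@quad k V x y) by exact: shuffle_op_bilin.
move: u; apply: tens_lin_eq => [a z z'||u].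
- exact: qB.1.
- exact/deconc_sum_linear/bilin_summand.
move: v v_pos; apply: tens_pos_ind => [a z z'||v v0].
- by rewrite mulrDl -scalerAl qB.2.
- apply: deconc_sum_linear_param => [z|s t a z z']; first exact: bilin_summand.
  by rewrite fB.2 mulrDl scalerAl.
move: w w_pos; apply: tens_pos_ind => [a z z'||w w0].
- by rewrite mulrDr -scalerAr qB.2.
- apply: deconc_sum_linear_param => [z|s t a z z']; first exact: bilin_summand.
  by rewrite gB.2 mulrDr scalerAr.
exact: E.
Qed.

Theorem theorem1 (k : fieldType) (V : lmodType k) (u v w : tensalg V)
    (hv : tens_pos v) (hw : tens_pos w) :
  (u \NE (v * w) = \dec_(u1, u2 <- u) ((u1 \SE v) * (u2 \wedge w)) /\
   u \NE (v * w) = \dec_(u1, u2 <- u) ((u1 \succ v) * (u2 \NE w))) /\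
  (u \SE (v * w) = \dec_(u1, u2 <- u) ((u1 \SE v) * (u2 \vee w)) /\
   u \SE (v * w) = \dec_(u1, u2 <- u) ((u1 \succ v) * (u2 \SE w))) /\
  (u \SW (v * w) = \dec_(u1, u2 <- u) ((u1 \SW v) * (u2 \vee w)) /\
   u \SW (v * w) = \dec_(u1, u2 <- u) ((u1 \prec v) * (u2 \SE w))) /\
  (u \NW (v * w) = \dec_(u1, u2 <- u) ((u1 \SW v) * (u2 \wedge w)) /\
   u \NW (v * w) = \dec_(u1, u2 <- u) ((u1 \prec v) * (u2 \NE w))).
Proof.
have cut_last x y : quad x y u (v * w) = \dec_(u1, u2 <- u)
    (quad x false u1 v * (quad false y u2 w + quad true y u2 w)).
  apply: (quad_mul_dec (f := quad x false)
            (g := fun s t => quad false y s t + quad true y s t)) => //.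
  - exact: shuffle_op_bilin.
  - by apply: bilinD; exact: shuffle_op_bilin.
  - by move=> *; exact: quad_cut_last.
have cut_first x y : quad x y u (v * w) = \dec_(u1, u2 <- u)
    ((quad x true u1 v + quad x false u1 v) * quad false y u2 w).
  apply: (quad_mul_dec (f := fun s t => quad x true s t + quad x false s t)
            (g := quad false y)) => //.
  - by apply: bilinD; exact: shuffle_op_bilin.
  - exact: shuffle_op_bilin.
  - by move=> *; exact: quad_cut_first.
(* The summands in both cuts are ordered as in the derived operations, so each identity is an
   instance up to conversion. *)
split; first by split; [exact: (cut_last false true)|exact: (cut_first false true)].
split; first by split; [exact: (cut_last false false)|exact: (cut_first false false)].
split; first by split; [exact: (cut_last true false)|exact: (cut_first true false)].
by split; [exact: (cut_last true true)|exact: (cut_first true true)].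
Qed.
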